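(* The problem Disconnected Perfect Matching is solvable in polynomial time on bipartite graphs of radius at most $2$.
   Context: Graphs are finite, simple and undirected. The distance $\mathrm{dist}(u,v)$ is the length of a shortest path from $u$ to $v$; a graph has radius at most $r$ if there is a vertex $v$ such that $\mathrm{dist}(v,u)\le r$ for all vertices $u$ (in particular such a graph is connected). A matching $M\subseteq E(G)$ is a set of pairwise non-adjacent edges; it is perfect if every vertex of $G$ is incident to an edge of $M$. A matching $M$ is a matching cut of $G$ if there is a partition of $V(G)$ into two non-empty sets $A$ and $B$ such that the edges of $M$ are exactly the edges of $G$ with one endvertex in $A$ and one in $B$. A disconnected perfect matching of $G$ is a matching cut of $G$ that is contained in some perfect matching of $G$. The decision problem Disconnected Perfect Matching takes a graph $G$ as input and asks whether $G$ has a disconnected perfect matching. *)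

(* Defs.v *)
From mathcomp Require Import all_boot.

Set Implicit Arguments.
Unset Strict Implicit.
Unset Printing Implicit Defensive.

(** * Graphs *)

(* Inputs of algorithms are labelled graphs, so vertices are 0, ..., n-1. *)
Record sgraph := SGraph {
  gorder : nat;
  adj : rel 'I_gorder;
  adj_sym : symmetric adj;
  adj_irr : irreflexive adj
}.

Definition vertex (G : sgraph) : finType := 'I_(gorder G).

Definition edges (G : sgraph) : {set {set vertex G}} :=
  [set E : {set vertex G} |
    [exists x : vertex G, exists y : vertex G,
       adj x y && (E == [set x; y])]].

Definition gpath (G : sgraph) (u v : vertex G) (p : seq (vertex G)) : Prop :=
  [/\ path (@adj G) u p, uniq (u :: p) & last u p = v].

(* The path [u :: p] has [size p] edges.  If [v] is not reachable from [u], no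
   [d] satisfies [is_dist u v d]. *)
Definition is_dist (G : sgraph) (u v : vertex G) (d : nat) : Prop :=
  (exists2 p, gpath u v p & size p = d) /\
  (forall p, gpath u v p -> d <= size p).

Definition radius_le (G : sgraph) (r : nat) : Prop :=
  exists v : vertex G, forall u : vertex G, exists2 d, is_dist v u d & d <= r.

Definition bipartite (G : sgraph) : Prop :=
  exists A : {set vertex G},
    forall x y : vertex G, adj x y -> (x \in A) != (y \in A).

Definition matching (G : sgraph) (M : {set {set vertex G}}) : Prop :=
  M \subset edges G /\
  {in M &, forall E F : {set vertex G}, E != F -> [disjoint E & F]}.

Definition perfect_matching (G : sgraph) (M : {set {set vertex G}}) : Prop :=
  matching M /\ (forall x : vertex G, exists2 E, E \in M & x \in E).

Definition edges_between (G : sgraph) (A B : {set vertex G}) :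
    {set {set vertex G}} :=
  [set E in edges G |
    [exists x in A, exists y in B, E == [set x; y]]].

Definition matching_cut (G : sgraph) (M : {set {set vertex G}}) : Prop :=
  matching M /\
  exists A B : {set vertex G},
    [/\ A != set0, B != set0, A :|: B = [set: vertex G], [disjoint A & B]
      & M = edges_between A B].

Definition disconnected_perfect_matching (G : sgraph)
    (M : {set {set vertex G}}) : Prop :=
  matching_cut M /\ (exists2 P, perfect_matching P & M \subset P).

Definition has_disconnected_perfect_matching (G : sgraph) : Prop :=
  exists M : {set {set vertex G}}, disconnected_perfect_matching M.

(** * Polynomial time *)

(* The machine model is the random access machine of Cook and Reckhow with
   unit cost per instruction, over registers X_0, X_1, ... holding natural
   numbers.  There is no multiplication: t steps produce numbers of at most
   O(t) bits, so polynomial time here is polynomial time on Turing machines. *)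
Inductive instr : Type :=
  | IConst of nat & nat           (* X_i := c *)
  | IAdd of nat & nat & nat       (* X_i := X_j + X_k *)
  | ISub of nat & nat & nat       (* X_i := X_j - X_k, truncated at 0 *)
  | IFetch of nat & nat           (* X_i := X_(X_j) *)
  | IStore of nat & nat           (* X_(X_i) := X_j *)
  | IJump of nat & nat            (* go to instruction m if X_j > 0 *)
  | IRead of nat.                 (* X_i := next input bit, 2 at end of input *)

Definition program := seq instr.

Record config := Config {
  pc : nat;
  regs : nat -> nat;
  inp : seq bool
}.

Definition upd (X : nat -> nat) (i v : nat) : nat -> nat :=
  fun j => if j == i then v else X j.

Definition exec (a : instr) (c : config) : config :=
  let: Config l X w := c in
  match a with
  | IConst i v => Config l.+1 (upd X i v) w
  | IAdd i j k => Config l.+1 (upd X i (X j + X k)) w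
  | ISub i j k => Config l.+1 (upd X i (X j - X k)) w
  | IFetch i j => Config l.+1 (upd X i (X (X j))) w
  | IStore i j => Config l.+1 (upd X (X i) (X j)) w
  | IJump j m => Config (if 0 < X j then m else l.+1) X w
  | IRead i => if w is b :: w' then Config l.+1 (upd X i (nat_of_bool b)) w'
               else Config l.+1 (upd X i 2) [::]
  end.

(* The machine halts when the program counter leaves the program; a halted
   configuration is unchanged by [step]. *)
Definition step (P : program) (c : config) : config :=
  if onth P (pc c) is Some a then exec a c else c.

Definition halted (P : program) (c : config) : bool := size P <= pc c.

Definition run (P : program) (w : seq bool) (t : nat) : config :=
  iter t (step P) (Config 0 (fun=> 0) w).

(* Within [t] steps, [P] halts on input [w] with answer [b], read off X_0. *)
Definition answers (P : program) (w : seq bool) (t : nat) (b : bool) : Prop :=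
  halted P (run P w t) /\ (0 < regs (run P w t) 0) = b.

(* The decision problem [Q], with instances in [T] encoded by [enc] and
   restricted to the class [C], is solvable in polynomial time.  Nothing is
   required of the program on inputs that do not encode an element of [C]. *)
Definition polytime_solvable_on (T : Type) (enc : T -> seq bool)
    (C Q : T -> Prop) : Prop :=
  exists (P : program) (a k : nat),
    forall x : T, C x ->
      exists (t : nat) (b : bool),
        [/\ t <= a * size (enc x) ^ k + a, answers P (enc x) t b & b <-> Q x].

(* The order in unary, a separator, then the adjacency matrix by rows. *)
Definition encode_graph (G : sgraph) : seq bool :=
  nseq (gorder G) true ++
  false :: [seq adj i j | i <- enum 'I_(gorder G), j <- enum 'I_(gorder G)].

(* Main.v *)
Require Import Defs.
From mathcomp Require Import all_boot all_fingroup zify.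

(** Let [G] be bipartite of radius at most 2, with center [c].  By parity, the
side of the bipartition that does not contain [c] is exactly the neighbourhood
of [c].  Suppose that the edges between [A] and its complement all lie in a
perfect matching, with [c] in [A].  At most one neighbour [y] of [c] lies
outside [A].  If there is one, the neighbours of [y] other than [c] lie outside
[A] too, and every edge leaving [y |: N(y) :\ c] leaves the complement of [A].
If there is none, a vertex [b] outside [A] has all its neighbours in [A], so it
has only one neighbour [a], and [b |: N(b) :\ a] is just [b].  Either way, a cut
that is contained in a perfect matching may be chosen among the stars
[y |: N(y) :\ v] with [v] and [y] adjacent ([follows_star]): there are only
polynomially many candidates, and no center has to be computed.

It remains to decide whether some perfect matching contains all the edges that
leave a given set.  This asks for a permutation [s] of the vertices such that
[s x] is adjacent to [x], and is the only possible other end of a crossing edge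
at [x]: in a bipartite graph, the restriction of [s] to one side is a perfect
matching ([matching_of_follows_cut]).  So the question is whether an [n] by [n]
bipartite relation has a perfect matching.  An auction decides it: vertices bid
for vertices, each unassigned bidder takes a cheapest object that it is allowed
to have, evicts the previous owner, and raises the price by one.  If a perfect
matching exists, no price ever exceeds [n] ([cheapest_price_lt]), so the bids
stop after at most [n * n] of them, with everybody assigned.

The algorithm is written in a small language whose loops all run [n] times, so
that its running time is polynomial by construction ([poly_time]).  A compiler
into random access machine code is proved correct once ([compileP]), and
everything else is about the functional semantics of the language. *)

Set Implicit Arguments.
Unset Strict Implicit.
Unset Printing Implicit Defensive.
Set Bullet Behavior "Strict Subproofs".

(** * Programs with bounded loops *)

(** The arrays of a program: the adjacency matrix, the prices and the owners of
the objects of an auction, and the answer, which is the entry 0 of its array. *)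
Inductive bank := Adj | Price | Owner | Answer.

Definition bank_code (b : bank) : nat :=
  match b with Adj => 0 | Price => 1 | Owner => 2 | Answer => 3 end.

Lemma bank_code_lt b : bank_code b < 4.
Proof. by case: b. Qed.

Definition store := bank -> nat -> nat.

Definition set_store (A : store) (b : bank) (i v : nat) : store :=
  fun b' j => if (bank_code b' == bank_code b) && (j == i) then v else A b' j.

(** [Sum x e] adds up [e] for [x] ranging over the naturals below [n].  Bounded
quantifiers are derived from it, so that tests need no loops of commands. *)
Inductive exp :=
  | Const of nat
  | Var of nat
  | Plus of exp & exp
  | Minus of exp & exp
  | Get of bank & exp
  | Sum of nat & exp.

Inductive cmd :=
  | Put of bank & exp & exp
  | Input of bank & exp
  | Seq of cmd & cmd
  | When of exp & cmd
  | For of nat & cmd.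

Fixpoint eval (n : nat) (A : store) (env : nat -> nat) (e : exp) : nat :=
  match e with
  | Const c => c
  | Var x => env x
  | Plus a b => eval n A env a + eval n A env b
  | Minus a b => eval n A env a - eval n A env b
  | Get b a => A b (eval n A env a)
  | Sum x a => \sum_(i < n) eval n A (upd env x i) a
  end.

Record state := State { cells : store; tape : seq bool }.

(** All loops run [n] times, so the meaning of a command is a total function.
Variables are bound by [For] and [Sum] only, and scoped lexically: commands
change the arrays and the input tape, never the environment. *)
Fixpoint sem (n : nat) (c : cmd) (env : nat -> nat) (s : state) : state :=
  let: State A w := s in
  match c with
  | Put b a e => State (set_store A b (eval n A env a) (eval n A env e)) w
  | Input b a =>
      State (set_store A b (eval n A env a)
               (if w is v :: _ then nat_of_bool v else 2)) (behead w)
  | Seq c1 c2 => sem n c2 env (sem n c1 env s)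
  | When e c1 => if 0 < eval n A env e then sem n c1 env s else s
  | For x c1 => iteri n (fun i => sem n c1 (upd env x i)) s
  end.

(** * Compilation to the random access machine *)

(** Registers are spread over the residues modulo 8, so that variables,
temporaries and arrays never meet whatever [n] is; register 0 is left for the
answer. *)
Definition size_reg := 8.
Definition var_reg (x : nat) := 8 * x + 1.
Definition tmp (d : nat) := 8 * d + 2.
Definition cell (b : bank) (i : nat) := 8 * i + (3 + bank_code b).

Definition move (i j : nat) : program := [:: IConst i 0; IAdd i i j].

(** A loop with index [x], executed at stack depth [d].  The old value of [x]
is saved in [tmp d] and restored at the end; [tmp d.+1] counts down from [n].
The test comes after the body, so the loop is only right for [0 < n]. *)
Definition loop (l d x : nat) (body : program) : program :=
  (move (tmp d) (var_reg x) ++ move (tmp d.+1) size_reg) ++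
  [:: ISub (var_reg x) size_reg (tmp d.+1)] ++ body ++
  [:: IConst (tmp d.+2) 1; ISub (tmp d.+1) (tmp d.+1) (tmp d.+2)] ++
  [:: IJump (tmp d.+1) (l + 4)] ++ move (var_reg x) (tmp d).

(** Turns the index in [tmp d] into the address of an array entry; the factor 8
comes from three doublings. *)
Definition cell_address (d : nat) (b : bank) : program :=
  [:: IAdd (tmp d) (tmp d) (tmp d); IAdd (tmp d) (tmp d) (tmp d);
      IAdd (tmp d) (tmp d) (tmp d); IConst (tmp d.+1) (3 + bank_code b);
      IAdd (tmp d) (tmp d) (tmp d.+1)].

Arguments cell_address : simpl never.

(** Code for position [l], which leaves the value in [tmp d].  The temporaries
from [d] on serve as a stack; all other registers have their old values in the
end, including the bound variable of a sum. *)
Fixpoint compile_exp (l d : nat) (e : exp) : program :=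
  match e with
  | Const c => [:: IConst (tmp d) c]
  | Var x => move (tmp d) (var_reg x)
  | Plus a b =>
      let p := compile_exp l d a in
      p ++ compile_exp (l + size p) d.+1 b ++
      [:: IAdd (tmp d) (tmp d) (tmp d.+1)]
  | Minus a b =>
      let p := compile_exp l d a in
      p ++ compile_exp (l + size p) d.+1 b ++
      [:: ISub (tmp d) (tmp d) (tmp d.+1)]
  | Get b a =>
      (compile_exp l d a ++ cell_address d b) ++ [:: IFetch (tmp d) (tmp d)]
  | Sum x a =>
      IConst (tmp d) 0 ::
      loop l.+1 d.+1 x (compile_exp (l + 6) (d + 4) a ++
                        [:: IAdd (tmp d) (tmp d) (tmp (d + 4))])
  end.

Fixpoint compile (l d : nat) (c : cmd) : program :=
  match c with
  | Put b a e =>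
      let p := compile_exp l d a ++ cell_address d b in
      p ++ compile_exp (l + size p) d.+1 e ++ [:: IStore (tmp d) (tmp d.+1)]
  | Input b a =>
      (compile_exp l d a ++ cell_address d b) ++
      [:: IRead (tmp d.+1); IStore (tmp d) (tmp d.+1)]
  | Seq c1 c2 =>
      let p := compile l d c1 in p ++ compile (l + size p) d c2
  | When e c1 =>
      let p := compile_exp l d e in
      let q := compile (l + size p + 3) d c1 in
      p ++ [:: IConst (tmp d.+1) 1; ISub (tmp d) (tmp d.+1) (tmp d);
               IJump (tmp d) (l + size p + 3 + size q)] ++ q
  | For x c1 => loop l d x (compile (l + 5) (d + 3) c1)
  end.

Fixpoint exp_time (n : nat) (e : exp) : nat :=
  match e with
  | Const _ => 1
  | Var _ => 2
  | Plus a b | Minus a b => exp_time n a + exp_time n b + 1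
  | Get _ a => exp_time n a + 6
  | Sum _ a => n * (exp_time n a + 5) + 7
  end.

Fixpoint time (n : nat) (c : cmd) : nat :=
  match c with
  | Put _ a e => exp_time n a + exp_time n e + 6
  | Input _ a => exp_time n a + 7
  | Seq c1 c2 => time n c1 + time n c2
  | When e c1 => exp_time n e + time n c1 + 3
  | For _ c1 => n * (time n c1 + 4) + 6
  end.

(** Bounding by a monomial is no loss for [0 < n], and makes the closure
properties immediate. *)
Definition poly_bounded (f : nat -> nat) : Prop :=
  exists a k, forall n, 0 < n -> f n <= a * n ^ k.

Lemma poly_const c : poly_bounded (fun=> c).
Proof. by exists c, 0 => n _; rewrite expn0 muln1. Qed.

Lemma poly_add f g :
  poly_bounded f -> poly_bounded g -> poly_bounded (fun n => f n + g n).
Proof.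
move=> [a [k fP]] [b [m gP]]; exists (a + b), (k + m) => n n_gt0.
rewrite mulnDl leq_add //.
  apply: leq_trans (fP n n_gt0) _.
  by rewrite leq_mul2l leq_pexp2l ?leq_addr ?orbT.
apply: leq_trans (gP n n_gt0) _.
by rewrite leq_mul2l leq_pexp2l ?leq_addl ?orbT.
Qed.

Lemma poly_mul_id f : poly_bounded f -> poly_bounded (fun n => n * f n).
Proof.
move=> [a [k fP]]; exists a, k.+1 => n n_gt0.
by rewrite expnS mulnCA leq_mul2l fP ?orbT.
Qed.

Lemma poly_exp_time e : poly_bounded (exp_time^~ e).
Proof.
elim: e => /= *; do ?[exact: poly_const | exact: poly_mul_id
  | assumption | apply: poly_mul_id | apply: poly_add].
Qed.

Lemma poly_time c : poly_bounded (time^~ c).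
Proof.
elim: c => /= *; do ?[exact: poly_const | exact: poly_exp_time
  | assumption | apply: poly_mul_id | apply: poly_add].
Qed.

(** * Correctness of the compiler *)

Definition outside_stack (d r : nat) : bool := (r < tmp d) || (r %% 8 != 2).

Lemma upd_eq X i v : upd X i v i = v.
Proof. by rewrite /upd eqxx. Qed.

Lemma upd_neq X i v j : j != i -> upd X i v j = X j.
Proof. by rewrite /upd => /negbTE->. Qed.

(* Distinct registers are told apart by linear arithmetic with remainders. *)
Ltac reg_lia :=
  unfold outside_stack, size_reg, var_reg, tmp, cell in *;
  repeat match goal with
  | |- context [bank_code ?b] =>
      lazymatch goal with
      | _ : is_true (bank_code b < 4) |- _ => fail
      | _ => have ? := bank_code_lt b
      end
  end; lia.

Ltac read_regs :=
  rewrite /=; repeat first [rewrite upd_eq | rewrite upd_neq; [|reg_lia]].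

Section Correctness.

Variable P : program.

Definition reaches (T : nat) (c c' : config) : Prop :=
  exists2 t, t <= T & iter t (step P) c = c'.

Lemma reaches0 c : reaches 0 c c.
Proof. by exists 0. Qed.

Lemma reaches_trans T1 T2 c1 c2 c3 :
  reaches T1 c1 c2 -> reaches T2 c2 c3 -> reaches (T1 + T2) c1 c3.
Proof.
move=> [t1 le1 e1] [t2 le2 e2]; exists (t2 + t1); first lia.
by rewrite iterD e1 e2.
Qed.

Lemma reaches_le T1 T2 c1 c2 : T1 <= T2 -> reaches T1 c1 c2 -> reaches T2 c1 c2.
Proof. by move=> le [t let1 e]; exists t => //; lia. Qed.

Definition code_at (l : nat) (q : program) : Prop :=
  forall i a, onth q i = Some a -> onth P (l + i) = Some a.

Lemma code_at_cat l q1 q2 :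
  code_at l (q1 ++ q2) -> code_at l q1 /\ code_at (l + size q1) q2.
Proof.
move=> cP; split=> i a q_i.
  apply: cP; rewrite onth_cat ifT //.
  by rewrite -onthTE q_i.
by rewrite -addnA; apply: cP; rewrite onth_cat ifN -?leqNgt ?leq_addr // addKn.
Qed.

Definition straight (a : instr) : bool :=
  if a is IJump _ _ then false else true.

(** The position 0 is a dummy: straight code does not depend on its position. *)
Definition after (q : program) (X : nat -> nat) (w : seq bool) : config :=
  foldl (fun c a => exec a c) (Config 0 X w) q.

Lemma exec_straight a l X w : straight a ->
  exec a (Config l X w) =
  Config l.+1 (regs (exec a (Config 0 X w))) (inp (exec a (Config 0 X w))).
Proof. by case: a => //= i _; case: w. Qed.

Lemma reaches_straight q l X w :
  code_at l q -> all straight q ->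
  reaches (size q) (Config l X w)
    (Config (l + size q) (regs (after q X w)) (inp (after q X w))).
Proof.
elim/last_ind: q => [|q a IH] cP.
  by move=> _; rewrite addn0; apply: reaches0.
rewrite all_rcons => /andP[sa sq].
move: cP; rewrite -cats1 => /code_at_cat[cq ca].
rewrite size_cat /=; apply: reaches_trans (IH cq sq) _.
exists 1 => //; rewrite iterS /step [pc _]/= -[X in onth P X]addn0 (ca 0 a) //.
rewrite exec_straight // /after foldl_cat -/(after q X w) addn1 addnS.
case: (after q X w) => k Y v; rewrite [foldl _ _ _]/= -/(exec a (Config k Y v)).
by rewrite [exec a (Config k Y v)]exec_straight.
Qed.

Lemma reaches_jump l X w j m :
  code_at l [:: IJump j m] ->
  reaches 1 (Config l X w) (Config (if 0 < X j then m else l.+1) X w).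
Proof.
move=> cP; exists 1 => //=.
by rewrite /step /= -[X in onth P X]addn0 (cP 0 (IJump j m)).
Qed.

Variable n : nat.
Hypothesis n_gt0 : 0 < n.

(** Positions computed by [code_at_cat] are sums of sizes, which have to be
rearranged before runs can be chained. *)
Lemma reaches_pc T l l' l1 l1' X w X' w' :
  l = l1 -> l' = l1' ->
  reaches T (Config l X w) (Config l' X' w') ->
  reaches T (Config l1 X w) (Config l1' X' w').
Proof. by move=> -> ->. Qed.

(** The rule for loops.  The invariant [Inv] has to ignore the registers that
the loop itself uses, and the body must not change the saved value of [x] and
the counter. *)
Lemma loopP (Inv : nat -> (nat -> nat) -> seq bool -> Prop) T l d x body X w :
  (forall i X X' w,
     (forall r, r != var_reg x -> outside_stack d r -> X' r = X r) ->
     Inv i X w -> Inv i X' w) ->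
  (forall i X w, Inv i X w -> X size_reg = n) ->
  (forall i X w, i < n -> Inv i X w -> X (var_reg x) = i ->
     exists X' w',
       [/\ reaches T (Config (l + 5) X w) (Config (l + 5 + size body) X' w'),
           Inv i.+1 X' w', X' (tmp d) = X (tmp d)
         & X' (tmp d.+1) = X (tmp d.+1)]) ->
  code_at l (loop l d x body) -> Inv 0 X w ->
  exists X' w',
    [/\ reaches (n * (T + 4) + 6) (Config l X w)
          (Config (l + size (loop l d x body)) X' w'),
        Inv n X' w' & X' (var_reg x) = X (var_reg x)].
Proof.
move=> stab sizeP bodyP.
move=> /code_at_cat[c1 /code_at_cat[c2 /code_at_cat[c3 /code_at_cat[c4]]]].
move=> /code_at_cat[c5 c6] I0.
set out := l + 4 + 1 + size body + 2 + 1.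
(* One round, from just before the index is set to just after the jump. *)
have turn i Y v : i < n -> Inv i Y v -> Y (tmp d.+1) = n - i ->
    exists Y' v', [/\ reaches (T + 4) (Config (l + 4) Y v)
      (Config (if i.+1 < n then l + 4 else out) Y' v'), Inv i.+1 Y' v',
      Y' (tmp d.+1) = n - i.+1 & Y' (tmp d) = Y (tmp d)].
  move=> lt_in Ii cnt.
  have := reaches_straight Y v c2 isT; set Y1 := regs _ => r1.
  have Y1x : Y1 (var_reg x) = i.
    by rewrite /Y1 /= upd_eq cnt (sizeP _ _ _ Ii); lia.
  have I1 : Inv i Y1 v.
    by apply: stab Ii => r rx rd; rewrite /Y1 /= upd_neq.
  have [Y2 [v2 [r2 I2 Y2d Y2c]]] := bodyP i Y1 v lt_in I1 Y1x.
  have := reaches_straight Y2 v2 c4 isT; set Y3 := regs _ => r3.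
  have I3 : Inv i.+1 Y3 v2.
    by apply: stab I2 => r rx rd; rewrite /Y3; read_regs.
  have Y3c : Y3 (tmp d.+1) = n - i.+1.
    by rewrite /Y3; read_regs; rewrite Y2c /Y1; read_regs; lia.
  exists Y3, v2; split=> //.
    have r4 := reaches_jump Y3 v2 c5; rewrite Y3c subn_gt0 in r4.
    have r12 := reaches_trans r1 (reaches_pc _ erefl r2).
    apply: reaches_le (reaches_trans (r12 _)
      (reaches_trans (reaches_pc _ erefl r3) (reaches_pc _ _ r4))).
    all: rewrite /=; try lia.
    by rewrite /out; case: ifP; lia.
  by rewrite /Y3; read_regs; rewrite Y2d /Y1; read_regs.
have turns k i Y v : n - i = k.+1 -> Inv i Y v -> Y (tmp d.+1) = k.+1 ->
    exists Y' v', [/\ reaches (k.+1 * (T + 4)) (Config (l + 4) Y v)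
      (Config out Y' v'), Inv n Y' v' & Y' (tmp d) = Y (tmp d)].
  elim: k i Y v => [|k IH] i Y v def_k Ii cnt.
    have [||Y' [v' [r I' _ eqd]]] := turn i Y v _ Ii _; [lia|lia|].
    exists Y', v'; rewrite ifN in r; last lia.
    by split=> //; [rewrite mul1n | have -> : n = i.+1 by lia].
  have [||Y1 [v1 [r1 I1 c1' eqd1]]] := turn i Y v _ Ii _; [lia|lia|].
  rewrite ifT in r1; last lia.
  have [||Y2 [v2 [r2 I2 eqd2]]] := IH i.+1 Y1 v1 _ I1 _; [lia|lia|].
  exists Y2, v2; split=> //; last by rewrite eqd2.
  by rewrite mulSn; apply: reaches_trans r1 r2.
have := reaches_straight X w c1 isT; set Y0 := regs _ => r0.
have I0' : Inv 0 Y0 w.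
  by apply: stab I0 => r rx rd; rewrite /Y0; read_regs.
have Y0c : Y0 (tmp d.+1) = n.
  by rewrite /Y0; read_regs; apply: sizeP I0.
have [||Y1 [v1 [r1 I1 eqd1]]] := turns n.-1 0 Y0 w _ I0' _;
  [by lia | by rewrite Y0c prednK |].
have := reaches_straight Y1 v1 c6 isT; set Y2 := regs _ => r2.
exists Y2, v1; split.
- have r01 := reaches_trans r0 (reaches_pc _ erefl r1).
  apply: reaches_le (reaches_trans (r01 _) (reaches_pc _ _ r2)).
  all: rewrite /out /= ?size_cat /= ?prednK //; lia.
- by apply: stab I1 => r rx rd; rewrite /Y2; read_regs.
- rewrite /Y2; read_regs.
  by rewrite eqd1 /Y0; read_regs.
Qed.

Definition represents (A : store) (env : nat -> nat) (X : nat -> nat) : Prop :=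
  [/\ X size_reg = n, forall x, X (var_reg x) = env x
    & forall b i, X (cell b i) = A b i].

Lemma represents_stack A env d X X' :
  represents A env X -> (forall r, outside_stack d r -> X' r = X r) ->
  represents A env X'.
Proof.
move=> [XN Xenv XA] kX.
by split=> [|x|b i]; rewrite kX ?XN ?Xenv ?XA //; reg_lia.
Qed.

Lemma cell_addressP l d b X w :
  code_at l (cell_address d b) ->
  exists X', [/\ reaches 5 (Config l X w) (Config (l + 5) X' w),
    X' (tmp d) = cell b (X (tmp d))
    & forall r, outside_stack d r -> X' r = X r].
Proof.
rewrite /cell_address => c.
have := reaches_straight X w c isT; set X1 := regs _ => r1.
exists X1; split=> //.
  by rewrite /X1; read_regs; rewrite /cell; lia.
by move=> r rd; rewrite /X1; read_regs.
Qed.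

Lemma compile_expP e A env l d X w :
  code_at l (compile_exp l d e) -> represents A env X ->
  exists X', [/\ reaches (exp_time n e) (Config l X w)
      (Config (l + size (compile_exp l d e)) X' w),
    X' (tmp d) = eval n A env e
    & forall r, outside_stack d r -> X' r = X r].
Proof.
elim: e env l d X => [c|x|a IHa b IHb|a IHa b IHb|b a IHa|x a IHa]
  env l d X /= cP [XN Xenv XA].
1-2: have := reaches_straight X w cP isT; set X1 := regs _ => r1.
1-2: by exists X1; split=> // [|r rd]; rewrite /X1; read_regs; rewrite ?Xenv.
1-2: move: cP => /code_at_cat[ca /code_at_cat[cb c3]].
1-2: have [X1 [r1 v1 k1]] := IHa _ _ _ _ ca (And3 XN Xenv XA).
1-2: have R1 := represents_stack (And3 XN Xenv XA) k1.
1-2: have [X2 [r2 v2 k2]] := IHb _ _ _ _ cb R1.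
1-2: have := reaches_straight X2 w c3 isT; set X3 := regs _ => r3.
1-2: have r23 := reaches_trans r2 r3.
1-2: exists X3; split=> [||r rd];
  [ | by rewrite /X3; read_regs; rewrite v2 k2 ?v1 //; reg_lia
    | by rewrite /X3; read_regs; rewrite k2 ?k1 //; reg_lia].
1-2: by apply: reaches_le (reaches_trans r1 (reaches_pc _ _ r23));
  rewrite /= ?size_cat /=; lia.
- move: cP => /code_at_cat[/code_at_cat[ca cb] c3].
  have [X1 [r1 v1 k1]] := IHa _ _ _ _ ca (And3 XN Xenv XA).
  have [X2 [r2 v2 k2]] := cell_addressP X1 w cb.
  have := reaches_straight X2 w c3 isT; set X3 := regs _ => r3.
  exists X3; split.
  + apply: reaches_le (reaches_trans r1 (reaches_trans r2 (reaches_pc _ _ r3))).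
    all: rewrite /= ?size_cat /=; lia.
  + rewrite /X3; read_regs; rewrite v2 v1 k2 ?k1 ?XA //; reg_lia.
  + by move=> r rd; rewrite /X3; read_regs; rewrite k2 ?k1 //; reg_lia.
- move: cP; rewrite -cat1s => /code_at_cat[c1 c2].
  have := reaches_straight X w c1 isT; set X1 := regs _ => r1.
  pose Inv i Y v := [/\ v = w, Y (tmp d) = \sum_(j < i) eval n A (upd env x j) a
    & forall r, r != var_reg x -> outside_stack d r -> Y r = X r].
  rewrite [size [:: _]]/= addn1 in c2.
  have [||||X2 [w2 [r2 [ew I2 k2] xd]]] :=
    @loopP Inv (exp_time n a + 1) _ _ _ _ X1 w _ _ _ c2 _.
  + move=> i Y Y' v kY [-> Yd Yk]; split=> // [|r rx rd].
      by rewrite kY //; reg_lia.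
    by rewrite kY ?Yk //; reg_lia.
  + by move=> i Y v [_ _ Yk]; rewrite Yk ?XN //; reg_lia.
  + move=> i Y v lt_in [-> Yd Yk] Yx.
    move: c2 => /code_at_cat[_ /code_at_cat[_ /code_at_cat[c2 _]]].
    move: c2 => /code_at_cat[c3 c4].
    have {}c3 : code_at (l + 6) (compile_exp (l + 6) (d + 4) a).
      by congr code_at: c3; rewrite /=; lia.
    have R : represents A (upd env x i) Y.
      split=> [|y|b j]; first by rewrite Yk ?XN //; reg_lia.
        rewrite /upd; case: eqP => [->|/eqP yx] //.
        by rewrite Yk ?Xenv //; reg_lia.
      by rewrite Yk ?XA //; reg_lia.
    have [Y1 [r3 v3 k3]] := IHa _ _ _ _ c3 R.
    have := reaches_straight Y1 w c4 isT; set Y2 := regs _ => r4.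
    exists Y2, w; split.
    * apply: reaches_le (reaches_trans (reaches_pc _ erefl r3) (reaches_pc _ _ r4)).
      all: rewrite /= ?size_cat /=; lia.
    * split=> //.
        by rewrite /Y2; read_regs; rewrite v3 k3 ?Yd ?big_ord_recr //; reg_lia.
      by move=> r rx rd; rewrite /Y2; read_regs; rewrite k3 ?Yk //; reg_lia.
    * by rewrite /Y2; read_regs; rewrite k3 //; reg_lia.
    * by rewrite /Y2; read_regs; rewrite k3 //; reg_lia.
  + split=> //; first by rewrite big_ord0 /X1; read_regs.
    by move=> r rx rd; rewrite /X1; read_regs.
  + rewrite ew in r2; exists X2; split=> //.
    { apply: reaches_le (reaches_trans r1 (reaches_pc _ _ r2)).
      all: rewrite /= ?size_cat /=; lia. }
    move=> r rd; case: (eqVneq r (var_reg x)) => [->|rx].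
      by rewrite xd /X1; read_regs.
    by rewrite k2 /X1; read_regs => //; reg_lia.
Qed.

Definition outside_cells (r : nat) : bool := r %% 8 < 3.

Lemma outside_cellsP r b i : outside_cells r -> r != cell b i.
Proof. by rewrite /outside_cells => ?; reg_lia. Qed.

Lemma cell_inj b i b' i' :
  (cell b i == cell b' i') = (bank_code b == bank_code b') && (i == i').
Proof. by apply/idP/idP; reg_lia. Qed.

Lemma set_storeP A b i v X :
  (forall b' j, X (cell b' j) = A b' j) ->
  forall b' j, upd X (cell b i) v (cell b' j) = set_store A b i v b' j.
Proof. by move=> XA b' j; rewrite /upd /set_store cell_inj XA. Qed.

Lemma compileP c A env w l d X :
  code_at l (compile l d c) -> represents A env X ->
  let s := sem n c env (State A w) in
  exists X', [/\ reaches (time n c) (Config l X w)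
      (Config (l + size (compile l d c)) X' (tape s)),
    forall b i, X' (cell b i) = cells s b i
    & forall r, outside_cells r -> outside_stack d r -> X' r = X r].
Proof.
elim: c env A w l d X => [b a e|b a|c1 IH1 c2 IH2|e c1 IH1|x c1 IH1]
  env A w l d X /= cP [XN Xenv XA].
- move: cP => /code_at_cat[/code_at_cat[ca cb] /code_at_cat[ce c3]].
  have [X1 [r1 v1 k1]] := compile_expP w ca (And3 XN Xenv XA).
  have R1 := represents_stack (And3 XN Xenv XA) k1.
  have [X2 [r2 v2 k2]] := cell_addressP X1 w cb.
  have R2 := represents_stack R1 k2.
  have [X3 [r3 v3 k3]] := compile_expP w ce R2.
  have [_ _ XA3] := represents_stack R2 k3.
  have := reaches_straight X3 w c3 isT; set X4 := regs _ => r4.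
  have r12 := reaches_trans r1 r2.
  have X3d : X3 (tmp d) = cell b (eval n A env a).
    by rewrite k3 ?v2 ?v1 //; reg_lia.
  exists X4; split.
  + apply: reaches_le (reaches_trans r12
      (reaches_trans (reaches_pc _ erefl r3) (reaches_pc _ _ r4))).
    all: rewrite /= ?size_cat /=; lia.
  + by move=> b' j; rewrite /X4 /= X3d v3; apply: set_storeP.
  + move=> r rc rd; rewrite /X4 /= X3d upd_neq ?outside_cellsP //.
    by rewrite k3 ?k2 ?k1 //; reg_lia.
- move: cP => /code_at_cat[/code_at_cat[ca cb] c3].
  have [X1 [r1 v1 k1]] := compile_expP w ca (And3 XN Xenv XA).
  have R1 := represents_stack (And3 XN Xenv XA) k1.
  have [X2 [r2 v2 k2]] := cell_addressP X1 w cb.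
  have [_ _ XA2] := represents_stack R1 k2.
  have := reaches_straight X2 w c3 isT; set X4 := regs _ => r4.
  have r12 := reaches_trans r1 r2.
  rewrite (_ : inp _ = behead w) in r4; last by case: (w).
  pose bit := if w is v :: _ then nat_of_bool v else 2.
  have X4E :
      X4 = upd (upd X2 (tmp d.+1) bit) (cell b (eval n A env a)) bit.
    by rewrite /X4 /bit; case: (w) => [|v w'] /=;
      rewrite upd_eq upd_neq ?v2 ?v1 //; reg_lia.
  exists X4; split.
  + apply: reaches_le (reaches_trans r12 (reaches_pc _ _ r4)).
    all: rewrite /= ?size_cat /=; lia.
  + move=> b' j; rewrite X4E (@set_storeP A) // => b1 j1.
    by rewrite upd_neq ?XA2 //; reg_lia.
  + move=> r rc rd; rewrite X4E upd_neq ?outside_cellsP // upd_neq; last reg_lia.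
    by rewrite k2 ?k1 //; reg_lia.
- move: cP => /code_at_cat[ca cb].
  have [X1 [r1 v1 k1]] := IH1 _ _ w _ _ _ ca (And3 XN Xenv XA).
  case: (sem n c1 env (State A w)) r1 v1 => A1 w1 /= r1 v1.
  have R1 : represents A1 env X1.
    by split=> [|x|//]; rewrite k1 ?XN ?Xenv /outside_cells //; reg_lia.
  have [X2 [r2 v2 k2]] := IH2 _ _ w1 _ _ _ cb R1.
  exists X2; split=> //.
  + by rewrite size_cat addnA; apply: reaches_trans r1 r2.
  + by move=> r rc rd; rewrite k2 ?k1.
- move: cP => /code_at_cat[ce]; rewrite -[[:: _, _ & _]]/([:: _; _] ++ [:: _] ++ _).
  move=> /code_at_cat[c2 /code_at_cat[c3 c4]].
  have [X1 [r1 v1 k1]] := compile_expP w ce (And3 XN Xenv XA).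
  have := reaches_straight X1 w c2 isT; set X2 := regs _ => r2.
  have r3 := reaches_jump X2 w c3.
  have X2d : X2 (tmp d) = 1 - eval n A env e by rewrite /X2; read_regs; rewrite v1.
  have k2 r : outside_stack d r -> X2 r = X r.
    by move=> rd; rewrite /X2; read_regs; rewrite k1.
  have R2 := represents_stack (And3 XN Xenv XA) k2.
  have r13 := reaches_trans r1 (reaches_trans r2 r3).
  rewrite X2d in r13.
  case: (posnP (eval n A env e)) r13 => [-> | e_gt0] r13.
    exists X2; split=> //.
    { apply: reaches_le (reaches_pc erefl _ r13).
      all: rewrite /= ?size_cat /=; lia. }
      by case: R2.
    by move=> r _; apply: k2.
  rewrite ifN in r13; last lia.
  set m := l + size (compile_exp l d e) + 3.
  have {}c4 : code_at m (compile m d c1).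
    by congr code_at: c4; rewrite /=; lia.
  have [X3 [r4 v4 k4]] := IH1 _ _ w _ _ _ c4 R2.
  exists X3; split=> //.
  { apply: reaches_le (reaches_trans r13 (reaches_pc _ _ r4)).
    all: rewrite /= ?size_cat /=; lia. }
  by move=> r rc rd; rewrite k4 ?k2.
- pose S i := iteri i (fun i => sem n c1 (upd env x i)) (State A w).
  pose Inv i Y v := [/\ v = tape (S i),
    forall b j, Y (cell b j) = cells (S i) b j
    & forall r, outside_cells r -> r != var_reg x -> outside_stack d r ->
        Y r = X r].
  have [||||X2 [w2 [r2 [ew I2 k2] xd]]] :=
    @loopP Inv (time n c1) _ _ _ _ X w _ _ _ cP _.
  + move=> i Y Y' v kY [ev YA Yk]; split=> // [b j|r rc rx rd].
      by rewrite kY //; reg_lia.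
    by rewrite kY ?Yk.
  + by move=> i Y v [_ _ Yk]; rewrite Yk ?XN //; reg_lia.
  + move=> i Y v lt_in [-> YA Yk] Yx.
    move: cP => /code_at_cat[_ /code_at_cat[_ /code_at_cat[c3 _]]].
    have {}c3 : code_at (l + 5) (compile (l + 5) (d + 3) c1).
      by congr code_at: c3; rewrite /=; lia.
    have R : represents (cells (S i)) (upd env x i) Y.
      split=> [|y|//]; first by rewrite Yk ?XN //; reg_lia.
      rewrite /upd; case: eqP => [->|/eqP yx] //.
      by rewrite Yk ?Xenv /outside_cells //; reg_lia.
    have [Y1 [r3 v3 k3]] := IH1 _ _ (tape (S i)) _ _ _ c3 R.
    have SE : State (cells (S i)) (tape (S i)) = S i by case: (S i).
    rewrite SE in r3 v3.
    exists Y1, (tape (S i.+1)); split=> //.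
    * by split=> // r rc rx rd; rewrite k3 ?Yk //; reg_lia.
    * by rewrite k3 /outside_cells; reg_lia.
    * by rewrite k3 /outside_cells; reg_lia.
  + by split.
  + rewrite ew in r2; exists X2; split=> //.
    move=> r rc rd; case: (eqVneq r (var_reg x)) => [->|rx] //.
    exact: k2.
Qed.
End Correctness.

(** * Polynomial time for decision problems on graphs *)

(** Reads the unary prefix of an encoded graph: each bit read is added to
[size_reg], until the separating 0, which adds nothing. *)
Definition read_size : program :=
  [:: IRead (tmp 0); IAdd size_reg size_reg (tmp 0); IJump (tmp 0) 0].

Lemma read_sizeP P k X w :
  code_at P 0 read_size ->
  exists X', [/\ reaches P (k.+1 * 3) (Config 0 X (nseq k true ++ false :: w))
      (Config 3 X' w),
    X' size_reg = X size_reg + k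
    & forall r, r != tmp 0 -> r != size_reg -> X' r = X r].
Proof.
move=> cP.
have [c1 c2] := @code_at_cat P 0 (take 2 read_size) (drop 2 read_size) cP.
elim: k X => [|k IH] X.
- have := reaches_straight X (false :: w) c1 isT; set X1 := regs _ => r1.
  have r2 := reaches_jump X1 w c2.
  exists X1; split.
  + by apply: reaches_trans r1 _; apply: r2.
  + by rewrite /X1; read_regs.
  + by move=> r r1' r2'; rewrite /X1; read_regs.
- have := reaches_straight X (nseq k.+1 true ++ false :: w) c1 isT.
  set X1 := regs _ => r1.
  have r2 := reaches_jump X1 (nseq k true ++ false :: w) c2.
  have [X2 [r3 N2 k2]] := IH X1.
  exists X2; split.
  + rewrite mulSn -[3]/(2 + 1) -addnA; apply: reaches_trans r1 _.
    by apply: reaches_trans r2 _; exact: r3.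
  + by rewrite N2 /X1; read_regs; lia.
  + by move=> r r1' r2'; rewrite k2 // /X1; read_regs.
Qed.

Definition graph_program (c : cmd) : program :=
  read_size ++ compile 3 0 c ++ [:: IAdd 0 0 (cell Answer 0)].

Definition adjacency_bits (G : sgraph) : seq bool :=
  [seq adj i j | i <- enum 'I_(gorder G), j <- enum 'I_(gorder G)].

Definition output (c : cmd) (G : sgraph) : nat :=
  cells (sem (gorder G) c (fun=> 0)
    (State (fun _ _ => 0) (adjacency_bits G))) Answer 0.

(** The bridge between the two models: a problem that a command of the language
decides is solvable in polynomial time, since the running time of the compiled
code is bounded by structural recursion and the encoding of a graph is at least
as long as its order. *)
Theorem polytime_of_cmd (C Q : sgraph -> Prop) (c : cmd) :
  (forall G, C G -> 0 < gorder G) ->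
  (forall G, C G -> 0 < output c G <-> Q G) ->
  polytime_solvable_on encode_graph C Q.
Proof.
move=> C_gt0 cP.
have [a [k ak]] : poly_bounded (fun n => (n * 3 + 3) + (time n c + 1)).
  do ?apply: poly_add; do ?exact: poly_const; first by apply/poly_mul_id/poly_const.
  exact: poly_time.
exists (graph_program c), a, k => G CG; set n := gorder G.
have n_gt0 : 0 < n by apply: C_gt0.
have cG : code_at (graph_program c) 0 (graph_program c) by [].
have [c1 /code_at_cat[c2 c3]] := code_at_cat cG.
have [X1 [r1 N1 k1]] := read_sizeP n (fun=> 0) (adjacency_bits G) c1.
have R1 : represents n (fun _ _ => 0) (fun=> 0) X1.
  by split=> *; rewrite ?N1 ?k1 //; reg_lia.
have [X2 [r2 v2 k2]] := compileP n_gt0 (adjacency_bits G) c2 R1.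
set w2 := tape _ in r2.
have := reaches_straight X2 w2 c3 isT; set X3 := regs _ => r3.
have [t let_t run_t] := reaches_trans r1 (reaches_trans r2 r3).
exists t, (0 < output c G); split.
- apply: leq_trans let_t _.
  have := ak n n_gt0; rewrite /= => ak_n.
  have : a * n ^ k <= a * size (encode_graph G) ^ k.
    rewrite leq_mul2l; apply/orP; right.
    case: (k) => // m; rewrite leq_exp2r //.
    by rewrite size_cat size_nseq leq_addr.
  by lia.
- have [v run_tv] : exists v,
      run (graph_program c) (encode_graph G) t =
      Config (size (graph_program c)) X3 v.
    eexists; apply: etrans run_t _; congr Config.
    by rewrite /graph_program !size_cat /= addnA.
  rewrite /answers /halted run_tv /=.
  split; first exact: leqnn.
  by rewrite /X3 /= upd_eq v2 k2 ?k1 //; reg_lia.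
- exact: cP.
Qed.

(** * Matching cuts in bipartite graphs of radius two *)

Section Graph.

Variable G : sgraph.
Implicit Types (x y z w : vertex G) (A B : {set vertex G}) (E F : {set vertex G}).

Lemma adj_neq x y : adj x y -> x != y.
Proof. by apply: contraTneq => ->; rewrite adj_irr. Qed.

Lemma edge_mem x y : adj x y -> [set x; y] \in edges G.
Proof.
move=> xy; rewrite inE; apply/existsP; exists x; apply/existsP; exists y.
by rewrite xy eqxx.
Qed.

Lemma edge_at E x : E \in edges G -> x \in E -> exists2 y, adj x y & E = [set x; y].
Proof.
rewrite inE => /existsP[a /existsP[b /andP[ab /eqP->]]] /set2P[]->; first by exists b.
by exists a; [rewrite adj_sym | rewrite setUC].
Qed.

Lemma set2_inj x y z : x != y -> [set x; y] = [set x; z] -> y = z.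
Proof.
move=> xy e; have := set22 x y; rewrite e => /set2P[yx|//].
by rewrite yx eqxx in xy.
Qed.

(** When [s] is an involution, it is a perfect matching that contains all the
edges leaving [B].  An injection turns out to be as good in bipartite graphs,
and spares the computation of the two sides. *)
Definition follows_cut (s : vertex G -> vertex G) B : Prop :=
  forall x, adj x (s x) /\
    forall w, adj x w -> (x \in B) != (w \in B) -> w = s x.

Lemma follows_cut_of_matching :
  has_disconnected_perfect_matching G ->
  exists (s : vertex G -> vertex G) B,
    [/\ injective s, B != set0, ~: B != set0 & follows_cut s B].
Proof.
move=> [M [[_ [A [B [A0 B0 AB dAB defM]]]] [P [[Pe Pd] Pc] MP]]].
have BE : B = ~: A.
  apply/setP => x; rewrite inE; have := in_setT x; rewrite -AB inE.
  by have [/(disjointFr dAB)->|] := boolP (x \in A).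
have share E F x : E \in P -> F \in P -> x \in E -> x \in F -> E = F.
  move=> PE PF xE xF; apply/eqP; apply: contraT => /(Pd _ _ PE PF) dEF.
  by rewrite (disjointFr dEF xE) in xF.
have [s sP] : exists s : vertex G -> vertex G,
    forall x, adj x (s x) /\ [set x; s x] \in P.
  apply: (fin_all_exists (P := fun x y => adj x y /\ [set x; y] \in P)) => x.
  have [E PE xE] := Pc x.
  have [y xy defE] := edge_at (subsetP Pe _ PE) xE.
  by exists y; rewrite -defE.
have s_mate x w : adj x w -> [set x; w] \in P -> w = s x.
  move=> xw Pxw; have [_ Pxs] := sP x.
  by apply: set2_inj (adj_neq xw) (share _ _ x Pxw Pxs _ _); rewrite set21.
have s_invol : involutive s.
  move=> x; have [xs Pxs] := sP x.
  by apply/esym/s_mate; rewrite 1?adj_sym // setUC.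
exists s, A; split; [exact: inv_inj | by [] | by rewrite -BE |].
move=> x; split=> [|w xw]; first by case: (sP x).
have cross a b : adj a b -> a \in A -> b \notin A -> [set a; b] \in P.
  move=> ab aA bA; apply: (subsetP MP); rewrite defM inE edge_mem //=.
  apply/existsP; exists a; rewrite aA; apply/existsP; exists b.
  by rewrite BE inE bA eqxx.
have [xA|xA] := boolP (x \in A); have [wA|wA] //= := boolP (w \in A) => _.
  by apply: s_mate => //; apply: cross.
by apply: s_mate => //; rewrite setUC; apply: cross; rewrite // adj_sym.
Qed.

Lemma follows_cutC s B : follows_cut s B -> follows_cut s (~: B).
Proof.
move=> sB x; have [xs sx] := sB x; split=> // w xw.
by rewrite !inE => neq; apply: sx => //; apply: contra neq => /eqP->.
Qed.

Lemma follows_cut_sub s A B :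
  (forall x w, adj x w -> x \in B -> w \notin B -> x \notin A /\ w \in A) ->
  follows_cut s A -> follows_cut s B.
Proof.
move=> BA sA x; have [xs sx] := sA x; split=> // w xw.
have [xB|xB] := boolP (x \in B); have [wB|wB] //= := boolP (w \in B) => _.
  by apply: sx => //; have [/negbTE-> ->] := BA _ _ xw xB wB.
rewrite adj_sym in xw.
by apply: sx; rewrite 1?adj_sym //; have [/negbTE-> ->] := BA _ _ xw wB xB.
Qed.

Hypothesis bipG : bipartite G.

(** An injective [s] maps the side [L] into its complement and conversely, so the
two sides have the same size and the pairs [x, s x] with [x] in [L] cover all
vertices.  Every crossing edge has an end in [L], so it is one of these pairs. *)
Lemma matching_of_follows_cut s B :
  injective s -> B != set0 -> ~: B != set0 -> follows_cut s B ->
  has_disconnected_perfect_matching G.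
Proof.
move=> s_inj B0 CB0 sB; have [L Lbip] := bipG.
have adj_s x : adj x (s x) by case: (sB x).
have side_s x : (s x \in L) = ~~ (x \in L).
  by have := Lbip _ _ (adj_s x); do 2!case: (_ \in L).
have sL : s @: L = ~: L.
  have sub1 : s @: L \subset ~: L.
    by apply/subsetP => _ /imsetP[x xL ->]; rewrite inE side_s xL.
  have sub2 : s @: (~: L) \subset L.
    by apply/subsetP => _ /imsetP[x xL ->]; rewrite side_s -in_setC.
  apply/eqP; rewrite eqEcard sub1 card_imset //.
  by have := subset_leq_card sub2; rewrite card_imset.
pose P := [set [set x; s x] | x in L].
have in_P z : z \in L -> [set z; s z] \in P.
  by move=> zL; apply/imsetP; exists z.
have P_edges : P \subset edges G.
  by apply/subsetP => _ /imsetP[x _ ->]; apply: edge_mem.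
have P_matching : matching P.
  split=> // E F /imsetP[x xL ->] /imsetP[z zL ->] neq.
  have xz : x != z by apply: contraNneq neq => ->.
  have xsz a b : a \in L -> b \in L -> a != s b.
    by move=> aL bL; apply: contraTneq aL => ->; rewrite side_s bL.
  rewrite disjoints_subset; apply/subsetP => w /set2P[]->; rewrite !inE negb_or.
    by rewrite xz xsz.
  by rewrite (inj_eq s_inj) xz eq_sym xsz.
have P_cover x : exists2 E, E \in P & x \in E.
  have [xL|xL] := boolP (x \in L).
    by exists [set x; s x]; rewrite ?set21 ?in_P.
  have : x \in s @: L by rewrite sL inE.
  case/imsetP => z zL def_x; exists [set z; s z]; first exact: in_P.
  by rewrite def_x set22.
have cutP : edges_between B (~: B) \subset P.
  apply/subsetP => E; rewrite inE => /andP[EG /existsP[a /andP[aB /existsP[b]]]].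
  rewrite inE => /andP[bB /eqP defE]; rewrite {E}defE in EG *.
  have ne_ab : a != b by apply: contraNneq bB => <-.
  have [y ay /(set2_inj ne_ab) def_y] := edge_at EG (set21 a b); subst y.
  have neqB : (a \in B) != (b \in B) by rewrite aB (negbTE bB).
  have [aL|aL] := boolP (a \in L).
    by rewrite ((sB a).2 b ay neqB) in_P.
  have bL : b \in L by have := Lbip _ _ ay; rewrite (negbTE aL); case: (b \in L).
  rewrite adj_sym in ay; rewrite eq_sym in neqB.
  by rewrite ((sB b).2 a ay neqB) setUC in_P.
exists (edges_between B (~: B)); split; last by exists P.
split; last first.
  by exists B, (~: B); rewrite setUCr; split=> //; rewrite disjoints_subset setCK.
have [_ Pd] := P_matching; split; first by apply: subset_trans cutP _.
by move=> E F /(subsetP cutP) PE /(subsetP cutP) PF; apply: Pd.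
Qed.

(** When [y] has the only neighbour [v], this is just [[set y]]. *)
Definition star_side v y : {set vertex G} :=
  [set x | (x == y) || adj y x && (x != v)].

Hypothesis radG : radius_le G 2.

(** Distances from [c] are at most 2, hence those that are odd are equal to 1. *)
Lemma dominating_center : exists c : vertex G, exists L : {set vertex G},
  (forall x y, adj x y -> (x \in L) != (y \in L)) /\
  (forall u, adj c u = (u \notin L)).
Proof.
have [L Lbip] := bipG; have [c cP] := radG.
have near u : adj c u = ((u \in L) != (c \in L)).
  apply/idP/idP => [/Lbip|]; first by rewrite eq_sym.
  have [d [[p [+ _ +] size_p] _] le_d] := cP u.
  case: p size_p => [|a [|b [|z p]]] /= size_p; last by rewrite -size_p in le_d.
      by move=> _ ->; rewrite eqxx.
    by rewrite andbT => ca <-.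
  case/and3P=> /Lbip ca /Lbip ab _ <-.
  by move: ca ab; do 3!case: (_ \in L).
exists c; have [cL|cL] := boolP (c \in L).
  by exists L; split=> // u; rewrite near cL; case: (_ \in L).
exists (~: L); split=> [x y|u].
  by rewrite !inE; move/Lbip; do 2!case: (_ \in L).
by rewrite near (negbTE cL) inE; case: (_ \in L).
Qed.

(** Every cut contained in a perfect matching can be replaced by one around a
star.  The center [c] may be assumed to be in [A].  If it has a neighbour [y]
outside [A], that neighbour is [s c], hence unique, and the star is that of [y]
without [c]; otherwise any vertex outside [A] is a leaf. *)
Lemma follows_star s A : A != set0 -> ~: A != set0 -> follows_cut s A ->
  exists v y, adj v y /\ follows_cut s (star_side v y).
Proof.
have [c [L [Lbip near]]] := dominating_center.
wlog cA : A / c \in A => [wlogA|] A0 CA0 sA.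
  have [cA|cA] := boolP (c \in A); first exact: (wlogA A).
  by apply: (wlogA (~: A)); rewrite ?inE ?setCK //; apply: follows_cutC.
have far x w : adj x w -> ~~ adj c x -> adj c w.
  by rewrite !near => /Lbip; do 2!case: (_ \in L).
have not_far x w : adj x w -> adj c x -> ~~ adj c w.
  by rewrite !near => /Lbip; do 2!case: (_ \in L).
have [y /andP[cy yA]|no_y] := pickP [pred y | adj c y && (y \notin A)].
- have y_sc : y = s c by apply: (sA c).2; rewrite // cA (negbTE yA).
  exists c, y; split=> //; apply: (follows_cut_sub _ sA) => x w xw.
  rewrite !inE !negb_or !negb_and negbK => xB /andP[wy wB].
  have xA : x \notin A.
    case/orP: xB => [/eqP->//|/andP[yx xc]]; apply/negP => xA.
    have ysx : x = s y by apply: (sA y).2; rewrite // xA (negbTE yA).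
    have ysc : c = s y by apply: (sA y).2; rewrite 1?adj_sym // cA (negbTE yA).
    by rewrite ysx -ysc eqxx in xc.
  split=> //; case/orP: xB => [/eqP xy|/andP[yx xc]].
    by move: wB; rewrite -xy xw /= => /eqP->.
  have cw : adj c w by apply: far xw (not_far _ _ yx cy).
  apply: contraT => wA; case/eqP: wy; rewrite y_sc.
  by apply: (sA c).2; rewrite // cA (negbTE wA).
- have nbrA u : adj c u -> u \in A.
    by move=> cu; have := no_y u; rewrite /= cu => /negbFE.
  have [b] := set0Pn _ CA0; rewrite inE => bA.
  have ncb : ~~ adj c b by apply: contra bA => /nbrA.
  have b_nbr w : adj b w -> w = s b.
    move=> bw; apply: (sA b).2; rewrite // (negbTE bA) (nbrA w) //.
    exact: far bw ncb.
  exists (s b), b; split; first by rewrite adj_sym; case: (sA b).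
  apply: (follows_cut_sub _ sA) => x w xw; rewrite !inE => xB _.
  have def_x : x = b.
    by case/orP: xB => [/eqP//|/andP[/b_nbr-> /eqP]].
  by rewrite def_x in xw *; split=> //; apply: nbrA; apply: far xw ncb.
Qed.

Theorem disconnected_perfect_matching_star :
  has_disconnected_perfect_matching G <->
  exists v y, adj v y /\
    exists2 s : vertex G -> vertex G,
      injective s & follows_cut s (star_side v y).
Proof.
split=> [/follows_cut_of_matching[s [B [s_inj B0 CB0 sB]]]|].
  have [v [y [vy sS]]] := follows_star B0 CB0 sB.
  by exists v, y; split=> //; exists s.
move=> [v [y [vy [s s_inj sS]]]].
apply: (matching_of_follows_cut s_inj _ _ sS); apply/set0Pn.
  by exists y; rewrite inE eqxx.
by exists v; rewrite !inE eqxx andbF orbF adj_neq.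
Qed.

End Graph.

(** * Perfect matchings of a relation by auction *)

Section Auction.

(* [al x z] says that the bidder [x] may have the object [z]; both range over
   the naturals below [n]. *)
Variables (n : nat) (al : rel nat).

Definition has_assignment : Prop :=
  exists s : 'S_n, forall x : 'I_n, al x (s x).

(** The invariant of an auction with prices [p] and owners [o], where [o j] is 0
for a free object [j] and [x.+1] when the bidder [x] has it.  By [slack], nobody
would save more than 1 by taking another object: an object is cheapest when it
is acquired, its price then rises by 1, and the other prices never fall. *)
Record auction (p o : nat -> nat) : Prop := Auction {
  owner_lt : forall j x, j < n -> o j = x.+1 -> x < n;
  owner_al : forall j x, j < n -> o j = x.+1 -> al x j;
  owner_inj : forall j k x, j < n -> k < n -> o j = x.+1 -> o k = x.+1 -> j = k;
  free_price : forall j, j < n -> o j = 0 -> p j = 0;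
  slack : forall j x z, j < n -> z < n -> o j = x.+1 -> al x z ->
    p j <= (p z).+1
}.

Definition unassigned (o : nat -> nat) (u : nat) : bool :=
  [forall j : 'I_n, o j != u.+1].

Definition cheapest (p : nat -> nat) (u z : nat) : bool :=
  al u z && [forall w : 'I_n, al u w ==> (p z <= p w)].

Definition total_price (p : nat -> nat) : nat := \sum_(j < n) p j.

Lemma auction0 p o :
  (forall j, j < n -> p j = 0) -> (forall j, j < n -> o j = 0) ->
  auction p o.
Proof.
move=> p0 o0.
split=> [j x /o0->|j x /o0->|j k x /o0->|j /p0->|j x z lj lz] //.
by rewrite o0.
Qed.

Lemma auction_bid p o u z : u < n -> z < n -> auction p o ->
  unassigned o u -> cheapest p u z ->
  auction (upd p z (p z).+1) (upd o z u.+1).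
Proof.
move=> lt_u lt_z [Olt Oal Oinj Ofree Oslack] /forallP un.
move=> /andP[al_uz /forallP cheap].
have nown j : j < n -> o j <> u.+1.
  by move=> lt_j; apply/eqP; have := un (Ordinal lt_j).
have minz w : w < n -> al u w -> p z <= p w.
  by move=> lt_w; have /implyP := cheap (Ordinal lt_w).
rewrite /upd; split.
- by move=> j x lt_j; case: eqP => [_ [<-]|_] //; apply: Olt.
- by move=> j x lt_j; case: eqP => [-> [<-]|_] //; apply: Oal.
- move=> j k x lt_j lt_k; case: eqP => [->|_]; case: eqP => [->|_] //.
  + by move=> [<-] /nown.
  + by move=> Oj [Ok]; rewrite -Ok in Oj; case: (nown j).
  + exact: Oinj.
- by move=> j lt_j; case: eqP => // _; apply: Ofree.
- move=> j x w lt_j lt_w; case: eqP => [_ [<-] al_uw|_ Oj al_xw].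
    by have := minz w lt_w al_uw; case: eqP => [->|_]; lia.
  by have := Oslack j x w lt_j lt_w Oj al_xw; case: eqP => [->|_]; lia.
Qed.

(** Otherwise all bidders, including [u], would be among the owners. *)
Lemma free_object p o u : u < n -> auction p o -> unassigned o u ->
  exists2 j, j < n & o j = 0.
Proof.
move=> lt_u [Olt _ Oinj _ _] /forallP un.
case: (pickP (fun j : 'I_n => o j == 0)) => [j /eqP oj|no]; first by exists j.
have [f fP] : exists f : 'I_n -> 'I_n, forall j : 'I_n, o j = (f j).+1.
  apply: (fin_all_exists (P := fun j x => o (val j) = (val x).+1)) => j.
  have := no j; case oj: (o j) => [|x] // _.
  by exists (Ordinal (Olt j x (ltn_ord j) oj)).
have f_inj : injective f.
  move=> j k ejk; apply/ord_inj.
  by apply: (Oinj _ _ (f j)); rewrite ?ltn_ord // fP // ejk.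
have [g _ gK] := injF_bij f_inj.
have := un (g (Ordinal lt_u)).
by rewrite fP gK eqxx.
Qed.

(** Suppose that the cheapest object [z] for an unassigned [u] costs at least
[n].  As there are only [n] objects, some price [t < n] is taken by none of
them.  The objects above [t] have owners, who by [slack] may only have objects
that cost at least [t], hence more than [t]; the same holds for [u].  So these
owners together with [u] are one too many for the objects above [t], against
Hall's condition. *)
Lemma cheapest_price_lt p o u z : u < n -> z < n -> has_assignment ->
  auction p o -> unassigned o u -> cheapest p u z -> p z < n.
Proof.
move=> lt_u lt_z [s sP] [Olt Oal Oinj Ofree Oslack] /forallP un.
move=> /andP[_ /forallP cheap]; rewrite ltnNge; apply/negP => le_n.
have [t no_t] : exists t : 'I_n, forall j : 'I_n, p j != t.
  case: (pickP (fun t : 'I_n => [forall j : 'I_n, p j != t])) => [t /forallP|hit].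
    by exists t.
  have [f fP] : exists f : 'I_n -> 'I_n, forall t : 'I_n, p (f t) = t.
    apply: (fin_all_exists (P := fun t j => p (val j) = val t)) => t.
    have := hit t => /negbT; rewrite negb_forall => /existsP[j /negPn/eqP pj].
    by exists j.
  have f_inj : injective f.
    by move=> t1 t2 e; apply/ord_inj; rewrite -(fP t1) e fP.
  have [g _ gK] := injF_bij f_inj.
  have := ltn_ord (g (Ordinal lt_z)); rewrite -fP gK /=; lia.
pose S := [set j : 'I_n | t < p j].
have [f fP] : exists f : 'I_n -> 'I_n, forall j : 'I_n, j \in S -> o j = (f j).+1.
  apply: (fin_all_exists (P := fun j x => j \in S -> o (val j) = (val x).+1)) => j.
  case oj: (o j) => [|x].
    exists j; rewrite inE (Ofree j) //.
  by exists (Ordinal (Olt j x (ltn_ord j) oj)).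
have f_inj : {in S &, injective f}.
  move=> j k Sj Sk ejk; apply/ord_inj; 
  by apply: (Oinj _ _ (f j)); rewrite ?ltn_ord // fP // ejk.
pose U := Ordinal lt_u.
have UfS : U \notin f @: S.
  apply/imsetP => -[j Sj Uj]; have := un j.
  by rewrite fP // -Uj eqxx.
have sub : s @: (U |: f @: S) \subset S.
  apply/subsetP => k /imsetP[x /setU1P[->|/imsetP[j Sj ->]] ->]; rewrite inE.
    have /implyP/(_ (sP U)) := cheap (s U).
    have := ltn_ord t; lia.
  have := Oslack _ _ _ (ltn_ord j) (ltn_ord (s (f j))) (fP j Sj) (sP _).
  have := no_t (s (f j)); move: Sj; rewrite inE; lia.
have := subset_leq_card sub.
by rewrite card_imset ?cardsU1 ?UfS ?card_in_imset ?ltnn //; apply: perm_inj.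
Qed.

Lemma exists_cheapest p u : u < n -> has_assignment ->
  exists2 z, z < n & cheapest p u z.
Proof.
move=> lt_u [s sP]; pose U := Ordinal lt_u.
case: (@arg_minnP _ (s U) (fun w : 'I_n => al u w) (fun w => p w) (sP U))
  => z al_z min_z.
exists z => //; rewrite /cheapest al_z; apply/forallP => w; apply/implyP.
exact: min_z.
Qed.

(** As long as somebody is unassigned, some object is free and costs 0. *)
Lemma total_bound p o u :
  u < n -> auction p o -> (forall j, j < n -> p j <= n) -> unassigned o u ->
  total_price p < n * n.
Proof.
move=> lt_u au p_le un; have [j lt_j oj] := free_object lt_u au un.
rewrite /total_price (bigD1 (Ordinal lt_j)) //= (free_price au) // add0n.
apply: (@leq_ltn_trans (\sum_(i < n | i != Ordinal lt_j) n)).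
  by apply: leq_sum => i _; apply: p_le.
rewrite sum_nat_const ltn_pmul2r; last lia.
rewrite -[X in _ < X]card_ord; apply: proper_card; apply/properP; split.
  exact/subsetP.
by exists (Ordinal lt_j); rewrite // unfold_in /= eqxx.
Qed.

Lemma assignment_of_auction p o : auction p o ->
  (forall u, u < n -> ~~ unassigned o u) -> has_assignment.
Proof.
move=> [Olt Oal Oinj _ _] assigned.
have [f fP] : exists f : 'I_n -> 'I_n, forall x : 'I_n, o (f x) = x.+1.
  apply: (fin_all_exists (P := fun x j => o (val j) = (val x).+1)) => x.
  have := assigned x (ltn_ord x); rewrite negb_forall => /existsP[j /negPn/eqP oj].
  by exists j.
have f_inj : injective f.
  by move=> x y e; apply/ord_inj; apply: succn_inj; rewrite -(fP x) e fP.
by exists (perm f_inj) => x; rewrite permE; apply: Oal.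
Qed.

Lemma total_bid p z : z < n -> total_price p < total_price (upd p z (p z).+1).
Proof.
move=> lt_z; rewrite /total_price (bigD1 (Ordinal lt_z)) //=.
rewrite [X in _ < X](bigD1 (Ordinal lt_z)) //=.
rewrite /upd eqxx ltnS leq_add2l.
apply: leq_sum => i _; case: eqP => // ->; lia.
Qed.

End Auction.

(** * Boolean formulas as expressions *)

(** An expression is true when it is positive, so disjunction is addition. *)
Definition enot e := Minus (Const 1) e.
Definition eor a b := Plus a b.
Definition eand a b := enot (eor (enot a) (enot b)).
Definition eimp a b := eor (enot a) b.
Definition ele a b := enot (Minus a b).
Definition eeq a b := eand (ele a b) (ele b a).
Definition exor a b := eor (eand a (enot b)) (eand b (enot a)).
Definition eex x e := Sum x e.
Definition eall x e := enot (Sum x (enot e)).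

Section Truth.

Variables (n : nat) (A : store) (env : nat -> nat).

Definition holds (e : exp) : bool := 0 < eval n A env e.

Lemma holds_not e : holds (enot e) = ~~ holds e.
Proof. by rewrite /holds /=; lia. Qed.

Lemma holds_or a b : holds (eor a b) = holds a || holds b.
Proof. by rewrite /holds /=; lia. Qed.

Lemma holds_and a b : holds (eand a b) = holds a && holds b.
Proof. by rewrite /holds /=; lia. Qed.

Lemma holds_imp a b : holds (eimp a b) = (holds a ==> holds b).
Proof. by rewrite holds_or holds_not implybE. Qed.

Lemma holds_le a b : holds (ele a b) = (eval n A env a <= eval n A env b).
Proof. by rewrite /holds /=; lia. Qed.

Lemma holds_eq a b : holds (eeq a b) = (eval n A env a == eval n A env b).
Proof. by rewrite holds_and !holds_le eqn_leq. Qed.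

Lemma holds_xor a b : holds (exor a b) = (holds a != holds b).
Proof. by rewrite holds_or !holds_and !holds_not; do 2!case: (holds _). Qed.

End Truth.

Lemma holds_ex n A env x e :
  holds n A env (eex x e) = [exists i : 'I_n, holds n A (upd env x i) e].
Proof.
rewrite /holds /= lt0n sum_nat_eq0 negb_forall.
by apply: eq_existsb => i; rewrite lt0n.
Qed.

Lemma holds_all n A env x e :
  holds n A env (eall x e) = [forall i : 'I_n, holds n A (upd env x i) e].
Proof.
rewrite /eall holds_not -/(eex x (enot e)) holds_ex negb_exists.
by apply: eq_forallb => i; rewrite holds_not negbK.
Qed.

(** * The algorithm *)

(** The variables 0 and 1 are the ends [v] and [y] of the edge that is tried, or
the indices of a matrix entry that is read; 2 is a bidder and 3 an object.  The
variables 4 and 5 count the sweeps of the auction, and 4, 6 and 7 are bound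
locally: 4 in the initialization and by quantifiers over objects, 6 by the
quantifier of [allowed], and 7 by the sum of [entry], which multiplies the
variable [x] by [n]. *)
Definition entry x z := Plus (Sum 7 (Var x)) (Var z).
Definition adjacent x z := Get Adj (entry x z).
Definition in_side x :=
  eor (eeq (Var x) (Var 1)) (eand (adjacent 1 x) (enot (eeq (Var x) (Var 0)))).
Definition crosses x z := eand (adjacent x z) (exor (in_side x) (in_side z)).
Definition allowed x z :=
  eand (adjacent x z) (eall 6 (eimp (crosses x 6) (eeq (Var 6) (Var z)))).
Definition owns x z := eeq (Get Owner (Var z)) (Plus (Var x) (Const 1)).
Definition bid_possible :=
  eand (eall 4 (enot (owns 2 4)))
      (eand (allowed 2 3)
           (eall 4 (eimp (allowed 2 4)
                       (ele (Get Price (Var 3)) (Get Price (Var 4)))))).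

Definition bid :=
  When bid_possible
    (Seq (Put Owner (Var 3) (Plus (Var 2) (Const 1)))
         (Put Price (Var 3) (Plus (Get Price (Var 3)) (Const 1)))).

(** A sweep tries all pairs of a bidder and an object, so it makes at least one
bid if any is possible. *)
Definition sweep := For 2 (For 3 bid).

Definition run_auction :=
  Seq (For 4 (Seq (Put Price (Var 4) (Const 0)) (Put Owner (Var 4) (Const 0))))
      (For 4 (For 5 sweep)).

Definition try_side :=
  Seq run_auction
      (When (eand (adjacent 0 1) (eall 2 (eex 4 (owns 2 4))))
            (Put Answer (Const 0) (Const 1))).

Definition read_matrix := For 0 (For 1 (Input Adj (entry 0 1))).

Definition main :=
  Seq read_matrix (For 0 (For 1 try_side)).

Lemma sem_seq n c1 c2 env s :
  sem n (Seq c1 c2) env s = sem n c2 env (sem n c1 env s).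
Proof. by case: s. Qed.

Lemma sem_when n e c env s :
  sem n (When e c) env s =
  if holds n (cells s) env e then sem n c env s else s.
Proof. by case: s. Qed.

Lemma sem_for n x c env s (I : nat -> state -> Prop) :
  I 0 s ->
  (forall i s', i < n -> I i s' -> I i.+1 (sem n c (upd env x i) s')) ->
  I n (sem n (For x c) env s).
Proof.
case: s => A w I0 step_I /=.
suff: forall k, k <= n ->
  I k (iteri k (fun i => sem n c (upd env x i)) (State A w)) by apply.
by elim=> //= k IH lt_kn; apply: step_I => //; apply: IH; apply: ltnW.
Qed.

Section Program.

Variables (n : nat) (M : nat -> nat).

(** The next four definitions are [adj], [star_side], the edges leaving it, and
the condition of [follows_cut] on the value of [s], for vertices taken as
naturals and the adjacency matrix stored in [M] by rows. *)
Definition madj (x z : nat) : bool := 0 < M (n * x + z).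

Definition side (v y x : nat) : bool := (x == y) || madj y x && (x != v).

Definition mcross v y x z : bool := madj x z && (side v y x != side v y z).

Definition mallowed v y x z : bool :=
  madj x z && [forall w : 'I_n, mcross v y x w ==> (w == z :> nat)].

Section Eval.

Variables (A : store) (env : nat -> nat).
Hypothesis AM : A Adj =1 M.

Lemma holds_adjacent x z : x != 7 ->
  holds n A env (adjacent x z) = madj (env x) (env z).
Proof.
move=> x7; rewrite /holds /= (eq_bigr (fun=> env x)) => [|i _]; last first.
  by rewrite upd_neq.
by rewrite sum_nat_const card_ord AM.
Qed.

Lemma holds_in_side x : x != 7 ->
  holds n A env (in_side x) = side (env 0) (env 1) (env x).
Proof. 
by move=> x7; rewrite holds_or holds_eq holds_and holds_not holds_eq
  holds_adjacent.
 Qed.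

Lemma holds_crosses x z : x != 7 -> z != 7 ->
  holds n A env (crosses x z) = mcross (env 0) (env 1) (env x) (env z).
Proof.
by move=> x7 z7; rewrite holds_and holds_xor holds_adjacent // !holds_in_side.
Qed.

End Eval.

Lemma holds_allowed A env x z : A Adj =1 M ->
  [&& x != 6, x != 7, z != 6 & z != 7] ->
  holds n A env (allowed x z) = mallowed (env 0) (env 1) (env x) (env z).
Proof.
move=> AM /and4P[x6 x7 z6 z7].
rewrite holds_and holds_all holds_adjacent //; congr (_ && _).
apply: eq_forallb => w; rewrite holds_imp holds_crosses // holds_eq /=.
by rewrite upd_eq !upd_neq //; lia.
Qed.

Lemma holds_owns A env x z :
  holds n A env (owns x z) = (A Owner (env z) == (env x).+1).
Proof. by rewrite holds_eq /= addn1. Qed.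

Variables v y a0 : nat.

Let al := mallowed v y.

(** Prices are bounded only if a perfect matching exists; the clauses on [M] and
[a0] say that an auction leaves the matrix and the answer alone. *)
Definition valid (s : state) : Prop :=
  [/\ cells s Adj =1 M, cells s Answer 0 = a0,
      auction n al (cells s Price) (cells s Owner)
    & has_assignment n al -> forall j, j < n -> cells s Price j <= n].

Definition can_bid (s : state) u z : bool :=
  unassigned n (cells s Owner) u && cheapest n al (cells s Price) u z.

Definition sum_prices (s : state) : nat := total_price n (cells s Price).

Definition all_assigned (s : state) : Prop :=
  forall u, u < n -> ~~ unassigned n (cells s Owner) u.

Lemma bidP s u z e : u < n -> z < n -> valid s ->
  e 0 = v -> e 1 = y -> e 2 = u -> e 3 = z ->
  let s' := sem n bid e s in
  valid s' /\
    (if can_bid s u z then is_true (sum_prices s < sum_prices s') else s' = s).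
Proof.
case: s => A w lt_u lt_z [AM Aa au cap] e0 e1 e2 e3.
rewrite /= -/(holds n A e bid_possible).
have -> : holds n A e bid_possible = can_bid (State A w) u z.
  rewrite holds_and holds_all holds_and holds_all holds_allowed // e0 e1 e2 e3.
  congr [&& _, _ & _]; apply: eq_forallb => k.
    by rewrite holds_not holds_owns /= upd_eq upd_neq ?e2.
  rewrite holds_imp holds_allowed // holds_le /=.
  by rewrite upd_eq !upd_neq ?e0 ?e1 ?e2 ?e3.
case: ifP => [/andP[un ch]|//].
rewrite e2 e3 !addn1; split; last exact: total_bid.
split=> //; first exact: auction_bid.
move=> has j lt_j; rewrite /= /set_store /=; case: eqP => _; last exact: cap.
exact: (cheapest_price_lt lt_u lt_z has au un ch).
Qed.

Lemma sweep_assigned s e : valid s -> e 0 = v -> e 1 = y -> all_assigned s ->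
  sem n sweep e s = s.
Proof.
move=> valid_s e0 e1 assigned.
apply: (sem_for (I := fun _ s' => s' = s)) => // i _ lt_i ->.
apply: (sem_for (I := fun _ s' => s' = s)) => // j _ lt_j ->.
have [_] :=
  @bidP s i j (upd (upd e 2 i) 3 j) lt_i lt_j valid_s e0 e1 erefl erefl.
by rewrite /can_bid (negbTE (assigned i lt_i)).
Qed.

(** A sweep without bids visits all pairs in the same state. *)
Lemma sweep_progress s e : valid s -> e 0 = v -> e 1 = y ->
  let s' := sem n sweep e s in
  valid s' /\
    (sum_prices s < sum_prices s' \/
     forall u z, u < n -> z < n -> ~~ can_bid s u z).
Proof.
move=> valid_s e0 e1 s'.
pose idle s1 u j := s1 = s /\
  forall w z, w < n -> z < n -> w < u \/ w = u /\ z < j -> ~~ can_bid s w z.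
suff [? [?|[_ no]]] : valid s' /\ (sum_prices s < sum_prices s' \/ idle s' n 0).
    by split=> //; left.
  by split=> //; right=> u z lt_u lt_z; apply: no => //; left.
apply: (sem_for (I := fun u s1 => valid s1 /\
  (sum_prices s < sum_prices s1 \/ idle s1 u 0))).
  by split=> //; right; split=> // w z _ _ [|[]].
move=> u s1 lt_u [valid1 prog1].
suff [? [?|[? no]]] : valid (sem n (For 3 bid) (upd e 2 u) s1) /\
    (sum_prices s < sum_prices (sem n (For 3 bid) (upd e 2 u) s1) \/
     idle (sem n (For 3 bid) (upd e 2 u) s1) u n).
    by split=> //; left.
  split=> //; right; split=> // w z lt_w lt_z [le_w|[_]] //.
  apply: no => //; rewrite ltnS leq_eqVlt in le_w.
  by case/orP: le_w => [/eqP->|]; [right|left].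
apply: (sem_for (I := fun j s1 => valid s1 /\
  (sum_prices s < sum_prices s1 \/ idle s1 u j))) => // j s2 lt_j [valid2 prog2].
have [valid3 prog3] :=
  @bidP s2 u j (upd (upd e 2 u) 3 j) lt_u lt_j valid2 e0 e1 erefl erefl.
split=> //; move: prog3; case: ifP => [_ lt23|can' ->].
  left; case: prog2 => [|[s2s _]]; first by move/ltn_trans; apply.
  by rewrite -s2s.
case: prog2 => [?|[s2s no]]; [by left|right; split=> // w z lt_w lt_z].
rewrite s2s in can'.
case=> [lt_wu|[wu]]; first by apply: no => //; left.
rewrite ltnS leq_eqVlt => /orP[/eqP->|lt_z']; first by rewrite wu can'.
by apply: no => //; right.
Qed.

(** Each sweep adds at least 1 to the sum of the prices until all bidders are
assigned.  That sum stays below [n * n], so [n * n] sweeps are enough. *)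
Lemma run_auctionP s e : 0 < n -> cells s Adj =1 M -> cells s Answer 0 = a0 ->
  e 0 = v -> e 1 = y ->
  let s' := sem n run_auction e s in
  valid s' /\ (has_assignment n al -> all_assigned s').
Proof.
move=> n_gt0 AM Aa e0 e1.
rewrite /run_auction sem_seq; set s0 := sem n _ e s.
have valid0 : valid s0.
  have [AM0 Aa0 z0] : [/\ cells s0 Adj =1 M, cells s0 Answer 0 = a0
      & forall j, j < n -> cells s0 Price j = 0 /\ cells s0 Owner j = 0].
    apply: (sem_for (I := fun i s1 => [/\ cells s1 Adj =1 M, cells s1 Answer 0 = a0
      & forall j, j < i -> cells s1 Price j = 0 /\ cells s1 Owner j = 0])) => //.
    move=> i [A w] lt_i [/= AM1 Aa1 z1]; split=> // j.
    rewrite /set_store /= upd_eq ltnS leq_eqVlt.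
    by case: eqP => //= _; apply: z1.
  split=> //; last by move=> _ j /z0[->].
  by apply: auction0 => j /z0[].
pose stage i s1 := valid s1 /\
  (has_assignment n al -> all_assigned s1 \/ i <= sum_prices s1).
have stage_sweep i s1 e' : e' 0 = v -> e' 1 = y ->
    stage i s1 -> stage i.+1 (sem n sweep e' s1).
  move=> e'0 e'1 [valid1 done1]; have [valid2 prog2] := sweep_progress valid1 e'0 e'1.
  split=> // has; have [ass|] := done1 has; first by left; rewrite sweep_assigned.
  case: prog2 => [? ?|no le_i]; first by right; lia.
  suff ass : all_assigned s1 by left; rewrite sweep_assigned.
  move=> u lt_u; apply/negP => un.
  have [z lt_z ch] := exists_cheapest (cells s1 Price) lt_u has.
  by have := no u z lt_u lt_z; rewrite /can_bid un ch.
have [valid1 done1] : stage (n * n) (sem n (For 4 (For 5 sweep)) e s0).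
  apply: (sem_for (I := fun i => stage (i * n))).
    by split=> // _; right.
  move=> i s1 lt_i st1; rewrite mulSn addnC.
  apply: (sem_for (I := fun j => stage (i * n + j))); first by rewrite addn0.
  by move=> j s2 lt_j st2; rewrite addnS; apply: stage_sweep.
split=> // has; have [//|le_nn] := done1 has.
move=> u lt_u; apply/negP => un; case: valid1 => _ _ au cap.
have := total_bound lt_u au (cap has) un; rewrite ltnNge.
by move/negP; apply.
Qed.

End Program.

Lemma nth_allpairs (S T R : Type) (r0 : R) (x0 : S) (y0 : T)
    (f : S -> T -> R) s t i j :
  i < size s -> j < size t ->
  nth r0 [seq f x y | x <- s, y <- t] (size t * i + j) =
  f (nth x0 s i) (nth y0 t j).
Proof.
elim: s i => //= x s IH [|i] lt_i lt_j; rewrite nth_cat size_map.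
  by rewrite muln0 add0n lt_j (nth_map y0).
by rewrite mulnS -addnA ltnNge leq_addr /= addKn IH.
Qed.

Lemma read_matrixP n A w e : size w = n * n ->
  let s := sem n read_matrix e (State A w) in
  (forall q, q < n * n -> cells s Adj q = nth false w q) /\
  cells s Answer 0 = A Answer 0.
Proof.
move=> size_w.
pose done q s := [/\ forall k, k < q -> cells s Adj k = nth false w k,
  tape s = drop q w & cells s Answer 0 = A Answer 0].
suff [] : done (n * n) (sem n read_matrix e (State A w)) by [].
apply: (sem_for (I := fun i => done (n * i))).
  by rewrite muln0; split; rewrite ?drop0.
move=> i s1 lt_i done1; rewrite mulnS addnC.
apply: (sem_for (I := fun j => done (n * i + j))); first by rewrite addn0.
move=> j [A2 w2] lt_j [/= A2w -> A2a]; rewrite sum_nat_const card_ord /upd /= addnS.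
have lt_q : n * i + j < size w by nia.
rewrite (drop_nth false lt_q); split=> //= k; rewrite /set_store /=.
by rewrite ltnS leq_eqVlt; case: eqP => [->|_] // /A2w.
Qed.

Definition matrix (G : sgraph) : nat -> nat :=
  cells (sem (gorder G) read_matrix (fun=> 0)
    (State (fun _ _ => 0) (adjacency_bits G))) Adj.

Lemma madj_matrix G (i j : vertex G) :
  madj (gorder G) (matrix G) i j = adj i j.
Proof.
set n' := gorder G.
have size_bits : size (adjacency_bits G) = n' * n'.
  by rewrite size_allpairs size_enum_ord.
have [readP _] := read_matrixP (fun _ _ => 0) (fun=> 0) size_bits.
have [lt_i lt_j] := (ltn_ord i, ltn_ord j).
rewrite /madj /matrix readP; last by rewrite -/n' in lt_i lt_j; nia.
have := @nth_allpairs _ _ _ false i i (@adj G) (enum 'I_n') (enum 'I_n') i j.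
by rewrite size_enum_ord => ->//; rewrite !nth_ord_enum; case: adj.
Qed.

Lemma try_sideP n M s e : 0 < n -> cells s Adj =1 M ->
  let s' := sem n try_side e s in
  cells s' Adj =1 M /\ (0 < cells s' Answer 0 <->
    0 < cells s Answer 0 \/
    madj n M (e 0) (e 1) /\ has_assignment n (mallowed n M (e 0) (e 1))).
Proof.
move=> n_gt0 AM.
have [[]] := run_auctionP n_gt0 AM erefl (erefl (e 0)) (erefl (e 1)).
rewrite /try_side sem_seq.
rewrite sem_when; set c := eand _ _.
case: (sem n run_auction e s) => A w /= AM1 Aa au _ ass.
have holds_c : holds n A e c = madj n M (e 0) (e 1) &&
    [forall u : 'I_n, ~~ unassigned n (A Owner) u].
  rewrite holds_and (holds_adjacent _ _ AM1) // holds_all; congr (_ && _).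
  apply: eq_forallb => u; rewrite holds_ex negb_forall; apply: eq_existsb => j.
  by rewrite holds_owns negbK.
have assignedP : [forall u : 'I_n, ~~ unassigned n (A Owner) u] <->
    has_assignment n (mallowed n M (e 0) (e 1)).
  split=> [/forallP un|/ass assigned]; last by apply/forallP => u; apply: assigned.
  by apply: assignment_of_auction au _ => u lt_u; apply: (un (Ordinal lt_u)).
rewrite holds_c; case: andP => [[adj_vy /assignedP has]|no] /=; split=> //.
  by split=> // _; right.
rewrite Aa; split; first by left.
by case=> // -[adj_vy /assignedP has]; case: no.
Qed.

Lemma mainP G : 0 < gorder G ->
  0 < output main G <->
  exists v y : vertex G,
    adj v y /\ has_assignment (gorder G) (mallowed (gorder G) (matrix G) v y).
Proof.
move=> n_gt0; pose n := gorder G; pose M := matrix G.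
have size_bits : size (adjacency_bits G) = gorder G * gorder G.
  by rewrite size_allpairs size_enum_ord.
have [_ answer0] := read_matrixP (fun _ _ => 0) (fun=> 0) size_bits.
pose ok v y := madj n M v y /\ has_assignment n (mallowed n M v y).
pose tried (T : nat -> nat -> Prop) s := cells s Adj =1 M /\
  (0 < cells s Answer 0 <->
   exists v y, [/\ T v y, v < n, y < n & ok v y]).
have [_ ->] : tried (fun v y => v < gorder G)
    (sem (gorder G) main (fun=> 0) (State (fun _ _ => 0) (adjacency_bits G))).
  rewrite /main sem_seq.
  apply: (sem_for (I := fun i => tried (fun v y => v < i))).
    split=> //; rewrite answer0; split=> // -[v [y [] //]].
  move=> i s1 lt_i tried1.
  suff [s2M s2P] : tried (fun v y => v < i \/ v = i /\ y < gorder G)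
      (sem (gorder G) (For 1 try_side) (upd (fun=> 0) 0 i) s1).
    split=> //; rewrite s2P.
    split=> -[v [y [T lt_v lt_y okvy]]]; exists v, y; split=> //.
      by lia.
    by move: T; rewrite ltnS leq_eqVlt => /orP[/eqP|]; [right|left].
  apply: (sem_for (I := fun j => tried (fun v y => v < i \/ v = i /\ y < j))).
    case: tried1 => s1M s1P; split=> //; rewrite s1P.
    by split=> -[v [y [T lt_v lt_y okvy]]]; exists v, y; split=> //; lia.
  move=> j s2 lt_j [s2M s2P].
  have [s3M s3P] := try_sideP (upd (upd (fun=> 0) 0 i) 1 j) n_gt0 s2M.
  split=> //; rewrite s3P s2P; split.
    case=> [[v [y [T lt_v lt_y okvy]]]|okij].
      by exists v, y; split=> //; lia.
    by exists i, j; split=> //; right; split.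
  move=> [v [y [T lt_v lt_y okvy]]].
  case: (eqVneq v i) => [vi|ne_v]; last first.
    left; exists v, y; split=> //; left.
    by case: T => // -[/eqP]; rewrite (negbTE ne_v).
  case: (eqVneq y j) => [yj|ne_y]; first by right; rewrite -vi -yj.
  by left; exists v, y; split=> //; lia.
split=> [[v [y [_ lt_v lt_y [adj_vy has]]]]|[v [y [adj_vy has]]]].
  exists (Ordinal lt_v), (Ordinal lt_y); split=> //.
  by rewrite -madj_matrix.
by exists v, y; split=> //; split=> //; rewrite /M madj_matrix.
Qed.

(** * Disconnected perfect matchings *)

Lemma has_assignmentP G (v y : vertex G) :
  has_assignment (gorder G) (mallowed (gorder G) (matrix G) v y) <->
  exists2 s : vertex G -> vertex G,
    injective s & follows_cut s (star_side v y).
Proof.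
set M := matrix G.
have MP := @madj_matrix G; rewrite -/M in MP.
have sideE (x : vertex G) : side (gorder G) M v y x = (x \in star_side v y).
  by rewrite inE /side MP.
have allowedP (x z : vertex G) : mallowed (gorder G) M v y x z <->
    adj x z /\ forall w, adj x w ->
      (x \in star_side v y) != (w \in star_side v y) -> w = z.
  rewrite /mallowed MP; split=> [/andP[xz /forallP cut]|[xz cut]].
    split=> // w xw neq; apply/ord_inj/eqP/(implyP (cut w)).
    by rewrite /mcross MP !sideE xw.
  rewrite xz; apply/forallP => w; apply/implyP; rewrite /mcross MP !sideE.
  by case/andP=> xw neq; rewrite (cut w).
split=> [[s sP]|[s s_inj sP]].
  by exists s => [|x]; [apply: perm_inj | apply/allowedP/sP].
by exists (perm s_inj) => x; rewrite permE; apply/allowedP/sP.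
Qed.

Theorem corollary17 :
  polytime_solvable_on encode_graph
    (fun G : sgraph => bipartite G /\ radius_le G 2)
    has_disconnected_perfect_matching.
Proof.
have order_gt0 G : bipartite G /\ radius_le G 2 -> 0 < gorder G.
  by case=> _ [c _]; apply: leq_ltn_trans (ltn_ord c).
apply: (polytime_of_cmd (c := main)) => // G [bipG radG].
apply: iff_trans (mainP (order_gt0 G (conj bipG radG))) _.
apply: iff_trans (iff_sym (disconnected_perfect_matching_star bipG radG)).
by split=> -[v [y [vy sP]]]; exists v, y; split=> //;
  apply/has_assignmentP.
Qed.
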